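(* Let $(\Omega,\mathcal{F},\mu)$ be a probability space. For any $1\le p\le\infty$ and any $f,g\in L^\infty(\Omega,\mu)$, $$\frac{2}{\|I-P\|_p+1}\,\|fg-\mathbb{E}(fg)\|_p\le \|g\|_\infty\|f-\mathbb{E}f\|_p+\|f\|_\infty\|g-\mathbb{E}g\|_p .$$
   Context: $L^\infty(\Omega,\mu)$ is the space of (classes of) complex-valued essentially bounded measurable functions on $\Omega$, with $\|\cdot\|_\infty$ the essential supremum norm, and $\|\cdot\|_p$ denotes the norm of $L^p(\Omega,\mu)$. For integrable $f$, $\mathbb{E}f=\int_\Omega f\,d\mu$, which is also regarded as a constant function. $P$ is the projection $f\mapsto \mathbb{E}f$ (a constant function) on $L^p(\Omega,\mu)$, $I$ is the identity operator, and $\|I-P\|_p$ is the operator norm of $I-P$ on $L^p(\Omega,\mu)$. *)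

(* Defs.v *)
From HB Require Import structures.
From mathcomp Require Import all_boot all_order all_algebra.
From mathcomp Require Import all_classical all_reals all_analysis.
From mathcomp Require Import complex.

Set Implicit Arguments.
Unset Strict Implicit.
Unset Printing Implicit Defensive.

Import Order.TTheory GRing.Theory Num.Theory.
Import numFieldNormedType.Exports.

Local Open Scope classical_set_scope.
Local Open Scope complex_scope.
Local Open Scope ring_scope.

Section ComplexLp.
Context d (T : measurableType d) (R : realType) (mu : {measure set T -> \bar R}).
Implicit Types (f : T -> R[i]) (p : \bar R).

(* Measurability for the Borel sigma-algebra of R[i] = R * R. *)
Definition cmeasurable f :=
  measurable_fun [set: T] (fun x => complex.Re (f x)) /\
  measurable_fun [set: T] (fun x => complex.Im (f x)).

Definition cLnorm p f : \bar R := Lnorm mu p (fun x => (Normc.normc (f x))%:E).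

(* L^p functions are represented by their members rather than by
   almost-everywhere classes; [cLnorm] and [cexpect] do not depend on the
   representative. *)
Definition cLp p : set (T -> R[i]) :=
  [set f | cmeasurable f /\ (cLnorm p f < +oo)%E].

Definition cexpect f : R[i] :=
  (\int[mu]_x complex.Re (f x)) +i* (\int[mu]_x complex.Im (f x)).

Definition expect_proj f : T -> R[i] := cst (cexpect f).

Definition Lp_opnorm p (A : (T -> R[i]) -> (T -> R[i])) : \bar R :=
  ereal_sup [set cLnorm p (A f) | f in [set f | cLp p f /\ (cLnorm p f <= 1)%E]].

End ComplexLp.

(* Main.v *)
Require Import Defs.
From HB Require Import structures.
From mathcomp Require Import all_boot all_order all_algebra.
From mathcomp Require Import all_classical all_reals all_analysis.
From mathcomp Require Import measurable_realfun ess_sup_inf complex.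
From mathcomp Require Import ring.

Set Implicit Arguments.
Unset Strict Implicit.
Unset Printing Implicit Defensive.

Import Order.TTheory GRing.Theory Num.Theory.
Import numFieldNormedType.Exports.

Local Open Scope classical_set_scope.
Local Open Scope complex_scope.
Local Open Scope ring_scope.

(** Write C = I - P for the centering operator.  Since C annihilates
constants, splitting each factor into its mean and its centered part gives
the exact identity ([center_mul])

  2 C(fg) = C(g Cf) + (Eg) Cf + C(f Cg) + (Ef) Cg.

The term C(g Cf) has L^p norm at most ||I - P||_p ||g||_oo ||Cf||_p, by the
definition of the operator norm and the pointwise bound |g| <= ||g||_oo,
whereas (Eg) Cf has norm at most ||g||_oo ||Cf||_p because |Eg| <= ||g||_oo.
So the first two terms together contribute at most
(||I - P||_p + 1) ||g||_oo ||Cf||_p ([cLnorm_half_le]), and the last two are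
the same with f and g exchanged.  Minkowski's inequality ([cLnormD]) and a
division by ||I - P||_p + 1 conclude.

Every function that occurs is essentially bounded, hence, on a probability
space, integrable and of finite L^p norm; this is what turns the extended real
inequality into a real one. *)

(** * The modulus of complex numbers *)

Section ComplexModulus.
Context (R : rcfType).
Implicit Types z w : R[i].
Local Notation normc := Normc.normc.

Lemma normc_ge0 z : 0 <= normc z.
Proof. by case: z => a b; exact: sqrtr_ge0. Qed.

Lemma sqr_normcE z : normc z ^+ 2 = complex.Re z ^+ 2 + complex.Im z ^+ 2.
Proof. by case: z => a b /=; rewrite sqr_sqrtr// addr_ge0// sqr_ge0. Qed.

(** Cauchy-Schwarz in the plane; by Lagrange's identity the difference of the
squares is the square of the cross product. *)
Lemma normr_dot_le_normc z w :
  `|complex.Re z * complex.Re w + complex.Im z * complex.Im w|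
    <= normc z * normc w.
Proof.
rewrite -(@ler_pXn2r _ 2)// ?nnegrE ?mulr_ge0 ?normc_ge0//.
rewrite real_normK ?num_real// exprMn !sqr_normcE -subr_ge0.
have := sqr_ge0 (complex.Re z * complex.Im w - complex.Im z * complex.Re w).
by congr (0 <= _); ring.
Qed.

Lemma normr_Re_le_normc z : `|complex.Re z| <= normc z.
Proof.
rewrite -(@ler_pXn2r _ 2)// ?nnegrE ?normc_ge0//.
by rewrite real_normK ?num_real// sqr_normcE lerDl sqr_ge0.
Qed.

Lemma normr_Im_le_normc z : `|complex.Im z| <= normc z.
Proof.
rewrite -(@ler_pXn2r _ 2)// ?nnegrE ?normc_ge0//.
by rewrite real_normK ?num_real// sqr_normcE lerDr sqr_ge0.
Qed.

Lemma normc_real (a : R) : 0 <= a -> normc (a%:C) = a.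
Proof. by move=> a0 /=; rewrite expr0n/= addr0 sqrtr_sqr ger0_norm. Qed.

End ComplexModulus.

(** * Measurability of complex-valued functions *)

Section Measurability.
Context d (T : measurableType d) (R : realType).
Implicit Types f g : T -> R[i].

Lemma cmeasurable_normc f : cmeasurable f ->
  measurable_fun [set: T] (fun x => Normc.normc (f x)).
Proof.
move=> [mRe mIm].
have -> : (fun x => Normc.normc (f x)) =
    Num.sqrt \o (fun x => complex.Re (f x) ^+ 2 + complex.Im (f x) ^+ 2).
  by apply/funext => x /=; case: (f x).
apply: measurableT_comp.
  by apply: continuous_measurable_fun; exact: sqrt_continuous.
by apply: measurable_funD; exact: measurable_funX.
Qed.

Lemma cmeasurable_cst (c : R[i]) : cmeasurable (cst c : T -> R[i]).
Proof. by split; exact: measurable_cst. Qed.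

Lemma cmeasurableD f g : cmeasurable f -> cmeasurable g ->
  cmeasurable (f \+ g).
Proof.
move=> [fR fI] [gR gI]; split.
  by under eq_fun do rewrite /= raddfD /=; exact: measurable_funD.
by under eq_fun do rewrite /= raddfD /=; exact: measurable_funD.
Qed.

Lemma cmeasurableM f g : cmeasurable f -> cmeasurable g ->
  cmeasurable (f \* g).
Proof.
move=> [fR fI] [gR gI]; split.
  rewrite (_ : (fun _ => _) =
      ((fun x => complex.Re (f x)) \* (fun x => complex.Re (g x)))
      \- ((fun x => complex.Im (f x)) \* (fun x => complex.Im (g x)))).
    by apply: measurable_funB; exact: measurable_funM.
  by apply/funext => x /=; case: (f x); case: (g x).
rewrite (_ : (fun _ => _) =
    ((fun x => complex.Re (f x)) \* (fun x => complex.Im (g x)))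
    \+ ((fun x => complex.Im (f x)) \* (fun x => complex.Re (g x)))).
  by apply: measurable_funD; exact: measurable_funM.
by apply/funext => x /=; case: (f x); case: (g x).
Qed.

End Measurability.

(** * Comparison and triangle inequality for complex L^p norms *)

Section LnormComparison.
Context d (T : measurableType d) (R : realType) (mu : {measure set T -> \bar R}).
Implicit Types (u v : T -> R) (f g : T -> R[i]) (p : \bar R).

(** Monotonicity and homogeneity in one statement: with M = 1 it compares
norms, with u = M v it gives the scaling inequality, and with M an essential
bound of a factor it is Hoelder's inequality between L^oo and L^p.  Infinite
norms are allowed. *)
Lemma le_Lnorm_scale p u v (M : R) : (1 <= p)%E -> 0 <= M ->
    measurable_fun [set: T] u -> measurable_fun [set: T] v ->
    (\forall x \ae mu, `|u x| <= M * `|v x|) ->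
  (Lnorm mu p (EFin \o u) <= M%:E * Lnorm mu p (EFin \o v))%E.
Proof.
move=> p1 M0 mu_ mv uv; rewrite unlock /Lnorm.
case: p p1 => [r r1|_|//].
- have r0 : 0 < r by rewrite (lt_le_trans ltr01).
  have mpow (w : T -> R) : measurable_fun [set: T] w ->
      measurable_fun [set: T] (fun x => (`|w x| `^ r)%:E).
    move=> mw; apply/measurable_EFinP.
    apply: (measurableT_comp (measurable_powR _)).
    exact: measurableT_comp.
  (* The factor M goes under the outer power 1/r, and then under the integral. *)
  have -> : M%:E = ((M `^ r)%:E `^ r^-1)%E.
    by rewrite poweR_EFin -powRrM mulfV ?gt_eqF// powRr1.
  rewrite -poweRM ?lee_fin ?powR_ge0 ?integral_ge0//; last first.
    by move=> x _; exact: poweR_ge0.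
  apply: gt0_ler_poweR.
  + by rewrite invr_ge0 ltW.
  + rewrite in_itv/= leey integral_ge0// => x _; exact: poweR_ge0.
  + rewrite in_itv/= leey mule_ge0 ?lee_fin ?powR_ge0 ?integral_ge0//.
  + rewrite -ge0_integralZl_EFin ?powR_ge0//; last first.
    * exact: mpow.
    * by move=> x _; exact: poweR_ge0.
    apply: ae_ge0_le_integral => //.
    * by move=> x _; exact: poweR_ge0.
    * exact: mpow.
    * by move=> x _; rewrite mule_ge0 ?lee_fin ?powR_ge0.
    * under eq_fun do rewrite /= -EFinM.
      apply/measurable_EFinP; apply: measurable_funM => //.
      by apply/measurable_EFinP; exact: mpow.
    apply: filterS uv => x uvx _ /=.
    rewrite -EFinM lee_fin -powRM//.
    by apply: ge0_ler_powR; rewrite ?nnegrE ?mulr_ge0// ltW.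
- case: ifPn => [mu0|]; last by rewrite mule0.
  rewrite -(ess_supZl _ mu0 M0). apply: le_ess_sup.
  by apply: filterS uv => x /=; rewrite -EFinM lee_fin.
Qed.

Lemma cLnorm_ge0 p f : (0 <= cLnorm mu p f)%E.
Proof. exact: Lnorm_ge0. Qed.

Lemma le_cLnorm_scale p f g (M : R) : (1 <= p)%E -> 0 <= M ->
    cmeasurable f -> cmeasurable g ->
    (\forall x \ae mu, Normc.normc (f x) <= M * Normc.normc (g x)) ->
  (cLnorm mu p f <= M%:E * cLnorm mu p g)%E.
Proof.
move=> p1 M0 mf mg fg; apply: le_Lnorm_scale => //;
  [exact: cmeasurable_normc | exact: cmeasurable_normc |].
by apply: filterS fg => x; rewrite !ger0_norm ?normc_ge0.
Qed.

(** Minkowski's inequality for the moduli |f| and |g|, which dominate |f + g|. *)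
Lemma cLnormD p f g : (1 <= p)%E -> cmeasurable f -> cmeasurable g ->
  (cLnorm mu p (f \+ g)%R <= cLnorm mu p f + cLnorm mu p g)%E.
Proof.
move=> p1 mf mg.
have mnf := cmeasurable_normc mf; have mng := cmeasurable_normc mg.
apply: (le_trans _ (eminkowski mu mnf mng p1)).
rewrite -[leRHS]mul1e; apply: le_Lnorm_scale => //.
- by apply: cmeasurable_normc; exact: cmeasurableD.
- exact: measurable_funD.
apply: nearW => x; rewrite mul1r !ger0_norm ?addr_ge0 ?normc_ge0//.
exact: le_normcD.
Qed.

Lemma cLnormZ p (c : R[i]) f : (1 <= p)%E -> cmeasurable f ->
  (cLnorm mu p (cst c \* f)%R <= (Normc.normc c)%:E * cLnorm mu p f)%E.
Proof.
move=> p1 mf; apply: le_cLnorm_scale => //; first exact: normc_ge0.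
- by apply: cmeasurableM => //; exact: cmeasurable_cst.
- by apply: nearW => x /=; rewrite Normc.normcM.
Qed.

End LnormComparison.

(** * Essentially bounded functions on a probability space *)

Section BoundedFunctions.
Context d (T : measurableType d) (R : realType) (mu : probability T R).
Implicit Types (f g : T -> R[i]) (u : T -> R) (p : \bar R) (c : R[i]).
Local Notation normc := Normc.normc.

(** [probability_setT] with its measure seen through the coercion to
[{measure set T -> \bar R}], the form in which norms and integrals mention
it. *)
Lemma measure_setT1 : (mu : {measure set T -> \bar R}) [set: T] = 1%E.
Proof. exact: probability_setT. Qed.

Lemma cLnorm_ooE f :
  cLnorm mu +oo f = ess_sup mu (fun x => (normc (f x))%:E).
Proof.
rewrite /cLnorm unlock /Lnorm ifT ?measure_setT1 ?lte01//.
by congr ess_sup; apply/funext => x /=; rewrite ger0_norm ?normc_ge0.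
Qed.

Lemma cLnorm_oo_leP f (M : R) :
  (cLnorm mu +oo f <= M%:E)%E <-> \forall x \ae mu, normc (f x) <= M.
Proof.
rewrite cLnorm_ooE; split => [/ess_supP|]; first exact: filterS.
by move=> fM; apply/ess_supP; apply: filterS fM => x; rewrite lee_fin.
Qed.

Lemma cLp_cLnorm_fineK p f : cLp mu p f -> (fine (cLnorm mu p f))%:E = cLnorm mu p f.
Proof. by move=> [_ foo]; rewrite fineK// ge0_fin_numE ?cLnorm_ge0. Qed.

Lemma cLoo_ae_le f : cLp mu +oo f ->
  \forall x \ae mu, normc (f x) <= fine (cLnorm mu +oo f).
Proof. by move=> foo; apply/cLnorm_oo_leP; rewrite cLp_cLnorm_fineK. Qed.

Lemma ae_bounded_cLoo f (M : R) : cmeasurable f ->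
  (\forall x \ae mu, normc (f x) <= M) -> cLp mu +oo f.
Proof.
by move=> mf /cLnorm_oo_leP fM; split => //; rewrite (le_lt_trans fM)// ltry.
Qed.

Lemma cLoo_cst c : cLp mu +oo (cst c).
Proof.
apply: (@ae_bounded_cLoo _ (normc c)); first exact: cmeasurable_cst.
by apply: nearW.
Qed.

Lemma cLooD f g : cLp mu +oo f -> cLp mu +oo g -> cLp mu +oo (f \+ g).
Proof.
move=> foo goo.
apply: (@ae_bounded_cLoo _ (fine (cLnorm mu +oo f) + fine (cLnorm mu +oo g))).
  by apply: cmeasurableD; [case: foo | case: goo].
apply: filterS2 (cLoo_ae_le foo) (cLoo_ae_le goo) => x fx gx.
exact: le_trans (le_normcD _ _) (lerD fx gx).
Qed.

Lemma cLooM f g : cLp mu +oo f -> cLp mu +oo g -> cLp mu +oo (f \* g).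
Proof.
move=> foo goo.
apply: (@ae_bounded_cLoo _ (fine (cLnorm mu +oo f) * fine (cLnorm mu +oo g))).
  by apply: cmeasurableM; [case: foo | case: goo].
apply: filterS2 (cLoo_ae_le foo) (cLoo_ae_le goo) => x fx gx.
by rewrite Normc.normcM ler_pM ?normc_ge0.
Qed.

Lemma cLooB f g : cLp mu +oo f -> cLp mu +oo g -> cLp mu +oo (f \- g).
Proof.
move=> foo goo.
have -> : f \- g = f \+ (cst (-1) \* g).
  by apply/funext => x /=; rewrite mulN1r.
by apply: cLooD => //; apply: cLooM => //; exact: cLoo_cst.
Qed.

(** Finiteness of the measure enters here, through the inclusion of L^oo in
L^p. *)
Lemma ae_bounded_Lfun p u (M : R) : (1 <= p)%E -> measurable_fun [set: T] u ->
  (\forall x \ae mu, `|u x| <= M) -> u \in Lfun mu p.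
Proof.
move=> p1 mu_ uM; have muT : mu [set: T] \is a fin_num.
  by rewrite probability_setT.
apply: (Lfun_subset p1 (leey _) muT (leey _)).
rewrite inE; apply/andP; split; rewrite inE//=.
rewrite /finite_norm unlock /Lnorm ifT ?measure_setT1 ?lte01//.
apply: (@le_lt_trans _ _ M%:E); last exact: ltry.
by apply/ess_supP; apply: filterS uM => x; rewrite lee_fin.
Qed.

Lemma cLoo_sub_cLp p f : (1 <= p)%E -> cLp mu +oo f -> cLp mu p f.
Proof.
move=> p1 foo; have [mf _] := foo; split => //.
have : (fun x => normc (f x)) \in Lfun mu p.
  apply: (@ae_bounded_Lfun _ _ (fine (cLnorm mu +oo f))) => //.
    exact: cmeasurable_normc.
  by apply: filterS (cLoo_ae_le foo) => x; rewrite ger0_norm ?normc_ge0.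
by rewrite inE => /andP[_]; rewrite inE.
Qed.

Lemma cLoo_integrable_Re f : cLp mu +oo f ->
  mu.-integrable [set: T] (EFin \o (fun x => complex.Re (f x))).
Proof.
move=> foo; apply/Lfun1_integrable.
apply: (@ae_bounded_Lfun _ _ (fine (cLnorm mu +oo f))) => //.
  by case: foo => -[].
apply: filterS (cLoo_ae_le foo) => x; apply: le_trans.
exact: normr_Re_le_normc.
Qed.

Lemma cLoo_integrable_Im f : cLp mu +oo f ->
  mu.-integrable [set: T] (EFin \o (fun x => complex.Im (f x))).
Proof.
move=> foo; apply/Lfun1_integrable.
apply: (@ae_bounded_Lfun _ _ (fine (cLnorm mu +oo f))) => //.
  by case: foo => -[].
apply: filterS (cLoo_ae_le foo) => x; apply: le_trans.
exact: normr_Im_le_normc.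
Qed.

(** * Expectation of complex-valued functions *)

Lemma cexpectD f g : cLp mu +oo f -> cLp mu +oo g ->
  cexpect mu (f \+ g) = cexpect mu f + cexpect mu g.
Proof.
move=> foo goo; apply/eqP; rewrite eq_complex /cexpect/=.
under eq_Rintegral do rewrite raddfD/=.
rewrite RintegralD//; [|exact: cLoo_integrable_Re|exact: cLoo_integrable_Re].
under [X in _ && (X == _)]eq_Rintegral do rewrite raddfD/=.
rewrite RintegralD//; [|exact: cLoo_integrable_Im|exact: cLoo_integrable_Im].
by rewrite !eqxx.
Qed.

Lemma integrable_EFinZl (a : R) u : mu.-integrable [set: T] (EFin \o u) ->
  mu.-integrable [set: T] (EFin \o (fun x => a * u x)).
Proof. by move=> iu; exact: (integrableZl measurableT a iu). Qed.

Lemma cexpectZ c f : cLp mu +oo f ->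
  cexpect mu (cst c \* f) = c * cexpect mu f.
Proof.
move=> foo; have iR := cLoo_integrable_Re foo; have iI := cLoo_integrable_Im foo.
apply/eqP; rewrite eq_complex /cexpect; case: c => a b /=.
have -> : \int[mu]_x complex.Re ((a +i* b) * f x) =
    \int[mu]_x (a * complex.Re (f x) - b * complex.Im (f x)).
  by apply: eq_Rintegral => x _; case: (f x).
have -> : \int[mu]_x complex.Im ((a +i* b) * f x) =
    \int[mu]_x (a * complex.Im (f x) + b * complex.Re (f x)).
  by apply: eq_Rintegral => x _; case: (f x).
rewrite RintegralB ?RintegralD//; try exact: integrable_EFinZl.
by rewrite !RintegralZl// !eqxx.
Qed.

Lemma cexpectB f g : cLp mu +oo f -> cLp mu +oo g ->
  cexpect mu (f \- g) = cexpect mu f - cexpect mu g.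
Proof.
move=> foo goo.
have -> : f \- g = f \+ (cst (-1) \* g).
  by apply/funext => x /=; rewrite mulN1r.
by rewrite cexpectD ?cexpectZ ?mulN1r//; apply: cLooM => //; exact: cLoo_cst.
Qed.

Lemma normr_Rintegral_le u (M : R) : 0 <= M ->
    mu.-integrable [set: T] (EFin \o u) ->
    (\forall x \ae mu, `|u x| <= M) ->
  `|\int[mu]_x u x| <= M.
Proof.
move=> M0 iu uM; have /integrableP[mu_ _] := iu.
rewrite -lee_fin EFin_normr_Rintegral//.
apply: (le_trans (le_abse_integral mu measurableT mu_)).
have -> : M%:E = (\int[mu]_x (cst M%:E x))%E.
  by rewrite integral_cst// measure_setT1 mule1.
apply: ae_ge0_le_integral => //; first exact: measurableT_comp.
by apply: filterS uM => x uMx _; rewrite /= lee_fin.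
Qed.

(** For z = E f, the real number |z|^2 is the expectation of the inner product
of z and f, and Cauchy-Schwarz bounds this inner product by |z| M. *)
Lemma normc_cexpect_le f (M : R) : 0 <= M -> cLp mu +oo f ->
  (\forall x \ae mu, normc (f x) <= M) -> normc (cexpect mu f) <= M.
Proof.
move=> M0 foo fM; have [mf _] := foo.
have iR := cLoo_integrable_Re foo; have iI := cLoo_integrable_Im foo.
set z := cexpect mu f.
pose h x := complex.Re z * complex.Re (f x) + complex.Im z * complex.Im (f x).
have ih : mu.-integrable [set: T] (EFin \o h).
  exact: (integrableD measurableT (integrable_EFinZl (complex.Re z) iR)
    (integrable_EFinZl (complex.Im z) iI)).
have zE : normc z ^+ 2 = \int[mu]_x h x.
  by rewrite sqr_normcE RintegralD ?RintegralZl//; exact: integrable_EFinZl.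
have hM : \forall x \ae mu, `|h x| <= normc z * M.
  apply: filterS fM => x fx; apply: le_trans (normr_dot_le_normc _ _) _.
  by rewrite ler_wpM2l ?normc_ge0.
have : normc z ^+ 2 <= normc z * M.
  rewrite zE (le_trans (ler_norm _))// normr_Rintegral_le//.
  by rewrite mulr_ge0 ?normc_ge0.
have [->//|z0] := eqVneq (normc z) 0.
by rewrite expr2 ler_pM2l// lt_neqAle eq_sym z0 normc_ge0.
Qed.

End BoundedFunctions.

(** * The centering operator I - P *)

Section Centering.
Context d (T : measurableType d) (R : realType) (mu : probability T R).
Implicit Types (f g h : T -> R[i]) (p : \bar R).
Local Notation normc := Normc.normc.

Definition center h : T -> R[i] := h \- expect_proj mu h.

Lemma cLoo_center f : cLp mu +oo f -> cLp mu +oo (center f).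
Proof. by move=> foo; apply: cLooB => //; exact: cLoo_cst. Qed.

Lemma centerZ (c : R[i]) h : cLp mu +oo h ->
  center (cst c \* h) = cst c \* center h.
Proof.
by move=> hoo; apply/funext => x; rewrite /center /expect_proj/= cexpectZ// mulrBr.
Qed.

(** The supremum is over a set that contains the norm of the image of 0. *)
Lemma Lp_opnorm_ge0 p (A : (T -> R[i]) -> (T -> R[i])) : (1 <= p)%E ->
  (0 <= Lp_opnorm mu p A)%E.
Proof.
move=> p1; apply: (@le_trans _ _ (cLnorm mu p (A (cst 0)))).
  exact: cLnorm_ge0.
apply: ereal_sup_ubound; exists (cst 0) => //; split.
  by apply: cLoo_sub_cLp => //; exact: cLoo_cst.
rewrite /cLnorm (_ : (fun _ => _) = cst 0%E).
  by rewrite Lnorm0 ?lee01// gt_eqF// (lt_le_trans _ p1).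
by apply/funext => x; congr EFin; exact: Normc.normc0.
Qed.

(** The operator norm only sees functions of norm at most 1, so h has to be
normalized.  Dividing by any s > 0 with ||h||_p <= s, and then letting s
decrease to ||h||_p, also covers the case ||h||_p = 0. *)
Lemma cLnorm_center_le p (r : R) h : (1 <= p)%E ->
    Lp_opnorm mu p center = r%:E -> cLp mu +oo h ->
  fine (cLnorm mu p (center h)) <= r * fine (cLnorm mu p h).
Proof.
move=> p1 rE hoo; have [mh _] := hoo.
have r0 : 0 <= r by rewrite -lee_fin -rE; exact: Lp_opnorm_ge0.
have hp := cLoo_sub_cLp p1 hoo.
have chp := cLoo_sub_cLp p1 (cLoo_center hoo).
have bound s : 0 < s -> fine (cLnorm mu p h) <= s ->
    fine (cLnorm mu p (center h)) <= r * s.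
  move=> s0 hs.
  pose k := cst (s^-1)%:C \* h.
  have koo : cLp mu +oo k by apply: cLooM => //; exact: cLoo_cst.
  have [mk _] := koo.
  have hk : h = cst s%:C \* k.
    apply/funext => x; rewrite /k /= mulrA -rmorphM/= mulfV ?gt_eqF//.
    by rewrite rmorph1 mul1r.
  have k1 : (cLnorm mu p k <= 1)%E.
    apply: (le_trans (cLnormZ mu _ p1 mh)).
    rewrite normc_real; last by rewrite invr_ge0 ltW.
    rewrite -(cLp_cLnorm_fineK hp) -EFinM lee_fin.
    by rewrite ler_pdivrMl// mulr1.
  have Ak : (cLnorm mu p (center k) <= r%:E)%E.
    rewrite -rE; apply: ereal_sup_ubound; exists k => //; split => //.
    exact: cLoo_sub_cLp.
  have [mck _] := cLoo_center koo.
  rewrite -lee_fin (cLp_cLnorm_fineK chp) [in leLHS]hk centerZ//.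
  apply: (le_trans (cLnormZ mu _ p1 mck)).
  rewrite normc_real; last exact: ltW.
  by rewrite [r * s]mulrC EFinM lee_pmul2l.
(* The increment e / (r + 1) costs r e / (r + 1) <= e and is defined for r = 0. *)
apply/ler_addgt0Pr => e e0.
have r1 : 0 < r + 1 by rewrite ltr_pwDr.
have e1 : 0 < e / (r + 1) by rewrite divr_gt0.
have h0 : 0 <= fine (cLnorm mu p h) by rewrite fine_ge0// cLnorm_ge0.
apply: le_trans (bound (fine (cLnorm mu p h) + e / (r + 1)) _ _) _.
- by rewrite ltr_wpDl.
- by rewrite lerDl ltW.
rewrite mulrDr lerD2l mulrCA ger_pMr// ler_pdivrMr// mul1r.
by rewrite lerDl.
Qed.

(** The product rule behind the theorem.  Both C(g Cf) and C(f Cg) produce a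
full copy of C(fg), and the two scalar terms compensate what the means of f
and g remove; the constants cancel since E(h Ck) = E(hk) - (Ek)(Eh). *)
Lemma center_mul f g : cLp mu +oo f -> cLp mu +oo g ->
  cst 2 \* center (f \* g) =
    ((center (g \* center f) \+ (cst (cexpect mu g) \* center f)) \+
     (center (f \* center g) \+ (cst (cexpect mu f) \* center g))).
Proof.
move=> foo goo.
have Emul h k : cLp mu +oo h -> cLp mu +oo k ->
    cexpect mu (h \* center k) =
    cexpect mu (h \* k) - cexpect mu k * cexpect mu h.
  move=> hoo koo; rewrite -cexpectZ// -cexpectB; first last.
  - by apply: cLooM => //; exact: cLoo_cst.
  - exact: cLooM.
  congr cexpect; apply/funext => x.
  by rewrite /center /expect_proj/=; ring.
apply/funext => x; rewrite /center /expect_proj/= !Emul//.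
have -> : cexpect mu (g \* f) = cexpect mu (f \* g).
  by congr cexpect; apply/funext => y; rewrite /= mulrC.
ring.
Qed.

Lemma cLnorm_mul_le p f h : (1 <= p)%E -> cLp mu +oo f -> cLp mu +oo h ->
  fine (cLnorm mu p (f \* h)) <= fine (cLnorm mu +oo f) * fine (cLnorm mu p h).
Proof.
move=> p1 foo hoo; have fhoo := cLooM foo hoo.
rewrite -lee_fin EFinM !cLp_cLnorm_fineK//; try exact: cLoo_sub_cLp.
rewrite -(cLp_cLnorm_fineK foo).
apply: le_cLnorm_scale => //; first by rewrite fine_ge0// cLnorm_ge0.
- by case: fhoo.
- by case: hoo.
apply: filterS (cLoo_ae_le foo) => x fx.
by rewrite /= Normc.normcM ler_wpM2r ?normc_ge0.
Qed.

Lemma normc_cexpect_le_cLnorm f : cLp mu +oo f ->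
  normc (cexpect mu f) <= fine (cLnorm mu +oo f).
Proof.
move=> foo; apply: normc_cexpect_le => //; last exact: cLoo_ae_le.
by rewrite fine_ge0// cLnorm_ge0.
Qed.

(** The part of [center_mul] in which f is centered: the operator norm
accounts for r, and the scalar multiple of the centered f for the summand
1. *)
Lemma cLnorm_half_le p (r : R) f g : (1 <= p)%E ->
    Lp_opnorm mu p center = r%:E -> cLp mu +oo f -> cLp mu +oo g ->
  fine (cLnorm mu p (center (g \* center f) \+ (cst (cexpect mu g) \* center f)))
    <= (r + 1) * (fine (cLnorm mu +oo g) * fine (cLnorm mu p (center f))).
Proof.
move=> p1 rE foo goo.
have r0 : 0 <= r by rewrite -lee_fin -rE; exact: Lp_opnorm_ge0.
have cf := cLoo_center foo; have [mcf _] := cf.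
have gcf := cLooM goo cf; have cgcf := cLoo_center gcf.
have Ecf := cLooM (cLoo_cst mu (cexpect mu g)) cf.
have sum := cLooD cgcf Ecf.
have fin k := @cLp_cLnorm_fineK _ _ _ mu p k.
apply: (@le_trans _ _ (fine (cLnorm mu p (center (g \* center f))) +
  fine (cLnorm mu p (cst (cexpect mu g) \* center f)))).
  rewrite -lee_fin EFinD !fin; try exact: cLoo_sub_cLp.
  by apply: cLnormD => //; [case: cgcf | case: Ecf].
rewrite mulrDl mul1r lerD//.
  apply: le_trans (cLnorm_center_le p1 rE gcf) _.
  by rewrite ler_wpM2l// cLnorm_mul_le.
apply: (@le_trans _ _ (normc (cexpect mu g) * fine (cLnorm mu p (center f)))).
  rewrite -lee_fin EFinM !fin; try exact: cLoo_sub_cLp.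
  exact: cLnormZ.
by rewrite ler_wpM2r ?fine_ge0 ?cLnorm_ge0// normc_cexpect_le_cLnorm.
Qed.

End Centering.

Theorem proposition2p2 (d : measure_display) (T : measurableType d)
    (R : realType) (mu : probability T R) (p : \bar R) (f g : T -> R[i])
    (hp : (1 <= p)%E) (hf : cLp mu +oo%E f) (hg : cLp mu +oo%E g) :
  (2%:E / (Lp_opnorm mu p (fun h => h \- expect_proj mu h)%R + 1)
     * cLnorm mu p ((f \* g) \- expect_proj mu (f \* g))%R
   <= cLnorm mu +oo g * cLnorm mu p (f \- expect_proj mu f)%R
      + cLnorm mu +oo f * cLnorm mu p (g \- expect_proj mu g)%R)%E.
Proof.
rewrite -/(center mu (f \* g)) -/(center mu f) -/(center mu g).
rewrite -[fun h => _]/(center mu).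
have c0 := Lp_opnorm_ge0 mu (center mu) hp.
move rE : (Lp_opnorm _ _ _) c0 => [r| |] // c0; last first.
  (* If the operator norm were +oo, the coefficient would be 2 / +oo = 0. *)
  by rewrite addye// invey mule0 mul0e adde_ge0// mule_ge0// cLnorm_ge0.
have r0 : 0 <= r by rewrite -lee_fin.
have r1 : 0 < r + 1 by rewrite ltr_pwDr.
have cf := cLoo_center hf; have cg := cLoo_center hg.
have fgoo := cLooM hf hg; have cfg := cLoo_center fgoo.
have [mcfg _] := cfg.
rewrite -EFinD inver gt_eqF// -EFinM.
have fin k := @cLp_cLnorm_fineK _ _ _ mu p k.
rewrite -(fin _ (cLoo_sub_cLp hp cfg)) -(fin _ (cLoo_sub_cLp hp cf)).
rewrite -(fin _ (cLoo_sub_cLp hp cg)).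
rewrite -(cLp_cLnorm_fineK hf) -(cLp_cLnorm_fineK hg) -!EFinM -EFinD lee_fin.
rewrite mulrAC ler_pdivrMr// [leRHS]mulrC mulrDr.
apply: le_trans (lerD (cLnorm_half_le hp rE hf hg) (cLnorm_half_le hp rE hg hf)).
have cfgE := center_mul hf hg.
set u := (X in _ = X \+ _) in cfgE; set v := (X in _ = _ \+ X) in cfgE.
have uoo : cLp mu +oo u.
  apply: cLooD; first by apply: cLoo_center; exact: cLooM.
  by apply: cLooM => //; exact: cLoo_cst.
have voo : cLp mu +oo v.
  apply: cLooD; first by apply: cLoo_center; exact: cLooM.
  by apply: cLooM => //; exact: cLoo_cst.
have uvoo := cLooD uoo voo.
have [[mu_ _] [mv _] [muv _]] := And3 uoo voo uvoo.
rewrite -ler_pdivlMl//.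
rewrite -lee_fin EFinM EFinD !fin; try exact: cLoo_sub_cLp.
apply: (@le_trans _ _ ((2^-1)%:E * cLnorm mu p (u \+ v)%R)%E).
  apply: le_cLnorm_scale => //; apply: nearW => x.
  rewrite -cfgE /= Normc.normcM mulrA.
  have -> : Normc.normc (2 : R[i]) = 2.
    by rewrite -[2 in LHS](rmorph_nat (real_complex R)) normc_real.
  by rewrite mulVf// mul1r.
by rewrite lee_pmul2l// cLnormD.
Qed.
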